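(* Let $a>0$ and $n\in\mathbb{N}$. For every sequence $(\mu_m)_m\subset B_a(K^n)$ and every $\mu\in B_a(K^n)$ the following equivalence holds: $\|\mu_m-\mu\|_{MK}\to0$ as $m\to\infty$ if and only if $\mu_m\to\mu$ in the weak$^*$ topology, i.e. if and only if $\int f\,d\mu_m\to\int f\,d\mu$ for every $f\in C(K^n)$.
   Context: $(T,d)$ is a compact metric space with at least two elements, with Borel $\sigma$-algebra $\mathcal{B}$. $K=\mathbb{R}$ or $K=\mathbb{C}$, $n\ge1$, and $X=K^n$ is equipped with its canonical Hilbert space structure, $(x\mid y)=\sum_i x_i\overline{y_i}$. $C(X)$ is the space of continuous functions $f:T\to X$ with the sup norm $\|f\|=\sup_{t\in T}\|f(t)\|$. $cabv(X)$ is the vector space over $K$ of $\sigma$-additive measures $\mu:\mathcal{B}\to X$ of bounded variation, where the variation is $|\mu|(A)=\sup\sum_i\|\mu(A_i)\|$ over finite partitions $(A_i)$ of $A$ into Borel sets; $\|\mu\|=|\mu|(T)$ is the variational norm; $B_a(X)=\{\mu\in cabv(X):\|\mu\|\le a\}$. Integral: for a simple function $f=\sum_{i=1}^m\varphi_{A_i}x_i$ ($A_i\in\mathcal{B}$, $x_i\in X$, $\varphi_{A}$ the indicator function of $A$) put $\int f\,d\mu=\sum_{i=1}^m(x_i\mid\mu(A_i))\in K$; for $f\in C(X)$ put $\int f\,d\mu=\lim_k\int f_k\,d\mu$, where $(f_k)$ is any sequence of simple functions converging uniformly to $f$ (the limit exists and does not depend on the sequence; the integral is linear in $f$, conjugate-linear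 in $\mu$, and $|\int f\,d\mu|\le\|\mu\|\|f\|$). $L(X)$ is the space of Lipschitz functions $f:T\to X$, $\|f\|_L$ is the least Lipschitz constant of $f$, $\|f\|_{BL}=\|f\|+\|f\|_L$, $BL_1(X)=\{f\in L(X):\|f\|_{BL}\le1\}$. The Monge-Kantorovich norm on $cabv(X)$ is $\|\mu\|_{MK}=\sup\{|\int f\,d\mu|: f\in BL_1(X)\}$. The weak$^*$ topology on $cabv(X)$ is the locally convex topology generated by the seminorms $\mu\mapsto|\int f\,d\mu|$, $f\in C(X)$. *)

(* Defs.v *)
From HB Require Import structures.
From mathcomp Require Import all_boot all_order all_algebra.
From mathcomp Require Import all_classical all_reals all_analysis.
From mathcomp.real_closed Require Import complex.

Set Implicit Arguments.
Unset Strict Implicit.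
Unset Printing Implicit Defensive.

Import Order.TTheory GRing.Theory Num.Theory.
Import numFieldNormedType.Exports.

Local Open Scope classical_set_scope.
Local Open Scope ring_scope.

Variant scalar_kind := RealScalars | ComplexScalars.

Definition scalar_field (R : realType) (k : scalar_kind) : numFieldType :=
  match k with RealScalars => R | ComplexScalars => R[i] end.

Definition scalar_conj (R : realType) (k : scalar_kind) :
    scalar_field R k -> scalar_field R k :=
  match k with RealScalars => id | ComplexScalars => @conjc R end.

Definition scalar_re (R : realType) (k : scalar_kind) : scalar_field R k -> R :=
  match k with RealScalars => id | ComplexScalars => @complex.Re R end.

(* The library norm of an element of [R[i]] is itself an element of [R[i]];
   [scalar_re] turns it into an element of [R]. *)
Definition scalar_abs (R : realType) (k : scalar_kind) (z : scalar_field R k) : R :=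
  scalar_re `|z|.

Section HilbertSpace.
Context {R : realType} {k : scalar_kind} {n : nat}.
Implicit Types x y : 'rV[scalar_field R k]_n.

Definition inner x y : scalar_field R k :=
  \sum_(i < n) x 0 i * scalar_conj (y 0 i).

(* This is not the library norm on row vectors, which is the maximum norm.
   Both induce the topology that the library puts on ['rV[scalar_field R k]_n]. *)
Definition hnorm x : R := Num.sqrt (scalar_re (inner x x)).

End HilbertSpace.

Section VectorMeasures.
Context {R : realType} {k : scalar_kind} {n : nat} {T : metricType R}.
Local Notation K := (scalar_field R k).
Local Notation X := ('rV[K]_n).

Definition borel : set (set T) := <<s [set A | open A] >>.

(* A vector measure is a total function on [set T]; everything below only
   depends on its values on Borel sets. *)
Implicit Types (mu nu : set T -> X) (f : T -> X).

Definition vsigma_additive mu : Prop :=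
  forall A : nat -> set T, (forall i, borel (A i)) -> trivIset setT A ->
    \sum_(i < N) mu (A i) @[N --> \oo] --> mu (\bigcup_i A i).

Definition vvariation mu (A : set T) : \bar R :=
  ereal_sup [set s | exists (p : nat) (B : 'I_p -> set T),
    [/\ forall i, borel (B i), trivIset setT B, \bigcup_i B i = A
      & s = (\sum_(i < p) hnorm (mu (B i)))%:E]].

Definition cabv : set (set T -> X) :=
  [set mu | vsigma_additive mu /\ (vvariation mu setT < +oo)%E].

Definition cabv_ball (a : R) : set (set T -> X) :=
  [set mu | cabv mu /\ (vvariation mu setT <= a%:E)%E].

Record simple_expr := SimpleExpr {
  se_len : nat;
  se_set : 'I_se_len -> set T;
  se_val : 'I_se_len -> X;
  se_borel : forall i, borel (se_set i) }.
Arguments se_set : clear implicits.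
Arguments se_val : clear implicits.

Definition simple_eval (s : simple_expr) (t : T) : X :=
  \sum_(i < se_len s) \1_(se_set s i) t *: se_val s i.

Definition simple_integral mu (s : simple_expr) : K :=
  \sum_(i < se_len s) inner (se_val s i) (mu (se_set s i)).

Definition converges_uniformly (s : nat -> simple_expr) f : Prop :=
  forall e : R, 0 < e ->
    \forall m \near \oo, forall t, hnorm (simple_eval (s m) t - f t) < e.

(* For [mu] in [cabv] and [f] continuous on a compact space, the set below is
   a singleton, so that the default value 0 of [xget] plays no role. *)
Definition vintegral mu f : K :=
  xget 0 [set l : K |
    (exists s, converges_uniformly s f) /\
    (forall s, converges_uniformly s f ->
      simple_integral mu (s m) @[m --> \oo] --> l)].

Definition sup_norm f : R := sup (range (fun t => hnorm (f t))).

Definition lipschitz_constants f : set R :=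
  [set L | 0 <= L /\ forall s t, hnorm (f s - f t) <= L * mdist s t].

Definition lipschitz_fun f : Prop := lipschitz_constants f !=set0.

(* For a Lipschitz [f] this infimum is attained. *)
Definition lip_norm f : R := inf (lipschitz_constants f).

Definition BL1 : set (T -> X) :=
  [set f | lipschitz_fun f /\ sup_norm f + lip_norm f <= 1].

Definition MK_norm mu : R := sup [set scalar_abs (vintegral mu f) | f in BL1].

(* Neighbourhoods of [mu] in the locally convex topology on [cabv] generated
   by the seminorms [nu |-> |vintegral nu f|], [f] continuous: finite
   intersections of seminorm balls centred at [mu] form a base. *)
Definition weak_star_nbhs mu : set_system (set T -> X) :=
  [set U | exists (p : nat) (F : 'I_p -> T -> X) (e : R),
    [/\ forall i, continuous (F i), 0 < e
      & [set nu | cabv nu /\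
           forall i, scalar_abs (vintegral (nu \- mu) (F i)) < e] `<=` U]].

End VectorMeasures.

(* Main.v *)
(** The uniform bound on the variations makes the functionals
    [f |-> vintegral (mu_ m \- mu) f] equicontinuous for the sup norm, so both
    directions reduce to Lipschitz test functions. A Lipschitz partition of
    unity [w] subordinate to a finite net [c] replaces [f] by its interpolation
    [sum_i w_i f(c_i)]. This is Lipschitz, which makes the Monge-Kantorovich norm
    control every continuous [f]. Conversely all functions of the unit ball of
    the bounded Lipschitz norm are interpolated, up to a common error, by
    combinations with coefficients bounded by 1 of the same finitely many
    continuous functions [w_i e_j], so convergence on these is already uniform
    on the ball. *)

Require Import Defs.
From mathcomp Require Import all_boot all_order all_algebra.
From mathcomp Require Import all_classical all_reals all_analysis.
From mathcomp Require Import ring lra.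
From mathcomp.real_closed Require Import complex.

Set Implicit Arguments.
Unset Strict Implicit.
Unset Printing Implicit Defensive.

Import Order.TTheory GRing.Theory Num.Theory.
Import numFieldNormedType.Exports.

Local Open Scope classical_set_scope.
Local Open Scope ring_scope.

(** * Scalars *)

Section Scalars.
Context {R : realType} {k : scalar_kind}.
Local Notation K := (scalar_field R k).
Implicit Types (x y : R) (z w : K).

(** The library norm takes its values in [K]; inequalities between norms are carried to [R] along
    this embedding. *)
Definition scalar_of_real : R -> K :=
  match k return R -> scalar_field R k with
  | RealScalars => id
  | ComplexScalars => fun x => (x +i* 0)%C
  end.

Lemma scalar_of_real0 : scalar_of_real 0 = 0.
Proof. by rewrite /scalar_of_real; case: k. Qed.

Lemma scalar_of_real1 : scalar_of_real 1 = 1.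
Proof. by rewrite /scalar_of_real; case: k. Qed.

Lemma scalar_of_realD x y :
  scalar_of_real (x + y) = scalar_of_real x + scalar_of_real y.
Proof.
rewrite /scalar_of_real; case: k => //.
exact: (raddfD (real_complex R)).
Qed.

Lemma scalar_of_realB x y :
  scalar_of_real (x - y) = scalar_of_real x - scalar_of_real y.
Proof.
rewrite /scalar_of_real; case: k => //.
exact: (raddfB (real_complex R)).
Qed.

Lemma scalar_of_realM x y :
  scalar_of_real (x * y) = scalar_of_real x * scalar_of_real y.
Proof.
rewrite /scalar_of_real; case: k => //.
exact: (rmorphM (real_complex R)).
Qed.

Lemma scalar_of_realK : cancel scalar_of_real (@scalar_re R k).
Proof. by rewrite /scalar_of_real /scalar_re; case: k. Qed.

Lemma ler_scalar_of_real x y :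
  (scalar_of_real x <= scalar_of_real y) = (x <= y).
Proof. rewrite /scalar_of_real; case: k => //; exact: lecR. Qed.

Lemma ltr_scalar_of_real x y :
  (scalar_of_real x < scalar_of_real y) = (x < y).
Proof. rewrite /scalar_of_real; case: k => //; exact: ltcR. Qed.

Lemma normr_scalar z : `|z| = scalar_of_real (scalar_abs z).
Proof.
rewrite /scalar_abs /scalar_of_real /scalar_re.
by move: z; case: k => // z /=; rewrite normc_def.
Qed.

(** A positive [z] equals its own norm, also over the complex numbers, where positive elements are
    real. *)
Lemma scalar_gt0P z : 0 < z -> exists2 x, 0 < x & z = scalar_of_real x.
Proof.
move=> z0; exists (scalar_abs z); last by rewrite -normr_scalar gtr0_norm.
by rewrite -ltr_scalar_of_real -normr_scalar scalar_of_real0 normr_gt0 gt_eqF.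
Qed.

Lemma scalar_abs_ge0 z : 0 <= scalar_abs z.
Proof. by rewrite -ler_scalar_of_real -normr_scalar scalar_of_real0. Qed.

Lemma scalar_abs0 : scalar_abs (0 : K) = 0.
Proof. by rewrite /scalar_abs normr0 -scalar_of_real0 scalar_of_realK. Qed.

Lemma scalar_absN z : scalar_abs (- z) = scalar_abs z.
Proof. by rewrite /scalar_abs normrN. Qed.

Lemma scalar_absB z w : scalar_abs (z - w) = scalar_abs (w - z).
Proof. by rewrite /scalar_abs distrC. Qed.

Lemma scalar_absD z w : scalar_abs (z + w) <= scalar_abs z + scalar_abs w.
Proof.
by rewrite -ler_scalar_of_real scalar_of_realD -!normr_scalar ler_normD.
Qed.

Lemma scalar_absM z w : scalar_abs (z * w) = scalar_abs z * scalar_abs w.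
Proof.
apply: (can_inj scalar_of_realK).
by rewrite scalar_of_realM -!normr_scalar normrM.
Qed.

Lemma scalar_abs_of_real x : scalar_abs (scalar_of_real x) = `|x|.
Proof.
rewrite /scalar_abs /scalar_re /scalar_of_real; case: k => //=.
by rewrite expr0n addr0 sqrtr_sqr.
Qed.

Lemma scalar_abs_sum (I : finType) (F : I -> K) :
  scalar_abs (\sum_i F i) <= \sum_i scalar_abs (F i).
Proof.
elim/big_ind2: _ => [|z x w y zx wy|//]; first by rewrite scalar_abs0.
exact: le_trans (scalar_absD _ _) (lerD zx wy).
Qed.

Lemma scalar_conj0 : scalar_conj (0 : K) = 0.
Proof. rewrite /scalar_conj; case: k => //; exact: conjc0. Qed.

Lemma scalar_conjD z w : scalar_conj (z + w) = scalar_conj z + scalar_conj w.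
Proof.
move: z w; rewrite /scalar_conj; case: k => // z w.
exact: (raddfD (@conjc R)).
Qed.

Lemma scalar_conjB z w : scalar_conj (z - w) = scalar_conj z - scalar_conj w.
Proof.
move: z w; rewrite /scalar_conj; case: k => // z w.
exact: (raddfB (@conjc R)).
Qed.

Lemma scalar_abs_conj z : scalar_abs (scalar_conj z) = scalar_abs z.
Proof.
rewrite /scalar_abs /scalar_conj; move: z; case: k => // z.
by rewrite normcJ.
Qed.

Lemma mulr_scalar_conj z : scalar_re (z * scalar_conj z) = scalar_abs z ^+ 2.
Proof.
apply: (can_inj (@scalar_of_realK)).
have -> : scalar_of_real (scalar_abs z ^+ 2) = `|z| ^+ 2.
  by rewrite normr_scalar expr2 scalar_of_realM.
move: z; rewrite /scalar_of_real /scalar_conj /scalar_re; case: k => /= z.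
  exact/esym/real_normK/num_real.
rewrite sqr_normc; apply: RRe_real; exact/ger0_real/mulcJ_ge0.
Qed.

Lemma scalar_reD z w : scalar_re (z + w) = scalar_re z + scalar_re w.
Proof. by move: z w; rewrite /scalar_re; case: k => // -[? ?] [? ?]. Qed.

Lemma scalar_re_sum (I : finType) (F : I -> K) :
  scalar_re (\sum_i F i) = \sum_i scalar_re (F i).
Proof.
elim/big_ind2: _ => [|z x w y <- <-|//]; last exact: scalar_reD.
by rewrite -scalar_of_real0 scalar_of_realK.
Qed.

(** By [scalar_gt0P] the [K]-valued radii of the library topology can be replaced by real ones. *)
Lemma cvg_scalarP (U : Type) (F : set_system U) {FF : Filter F} (f : U -> K) l :
  f @ F --> l <->
  forall e : R, 0 < e -> \forall u \near F, scalar_abs (f u - l) < e.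
Proof.
split=> [/cvgrPdist_lt h e e0|h].
  have := h (scalar_of_real e).
  rewrite -scalar_of_real0 ltr_scalar_of_real => /(_ e0).
  by apply: filterS => u; rewrite normr_scalar ltr_scalar_of_real scalar_absB.
apply/cvgrPdist_lt => e /scalar_gt0P[x x0 ->].
apply: filterS (h _ x0) => u.
by rewrite normr_scalar ltr_scalar_of_real scalar_absB.
Qed.

End Scalars.

Lemma real_cauchy_cvg (R : realType) (u : nat -> R) :
  (forall e, 0 < e -> exists N, forall m p, (N <= m)%N -> (N <= p)%N ->
     `|u m - u p| < e) ->
  exists l : R, u m @[m --> \oo] --> l.
Proof.
move=> h; apply/cvg_ex; apply: cauchy_cvg; apply: cauchy_exP => e e0.
have [N hN] := h _ e0; exists (u N).
by exists N => // m /= Nm; rewrite -ball_normE /=; exact: hN.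
Qed.

(** In the complex case the modulus dominates the real and imaginary parts, which are therefore
    Cauchy, and is dominated by the sum of their absolute values, which gives back convergence. *)
Lemma scalar_cauchy_cvg (R : realType) (k : scalar_kind)
    (u : nat -> scalar_field R k) :
  (forall e : R, 0 < e -> exists N, forall m p, (N <= m)%N -> (N <= p)%N ->
     scalar_abs (u m - u p) < e) ->
  exists l : scalar_field R k, u m @[m --> \oo] --> l.
Proof.
case: k u => u hu; first exact: (real_cauchy_cvg hu).
have abs_ge (z : R[i]) : `|complex.Re z| <= complex.Re `|z| /\
    `|complex.Im z| <= complex.Re `|z|.
  case: z => x y /=; rewrite -!sqrtr_sqr; split; rewrite ler_sqrt;
  by rewrite ?addr_ge0 ?sqr_ge0// ?lerDl ?lerDr sqr_ge0.
have abs_le (z : R[i]) : complex.Re `|z| <= `|complex.Re z| + `|complex.Im z|.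
  case: z => x y /=.
  rewrite -[leRHS]ger0_norm ?addr_ge0// -[leRHS]sqrtr_sqr ler_sqrt ?sqr_ge0//.
  rewrite sqrrD !real_normK ?num_real// lerD2r lerDl.
  by rewrite mulrn_wge0// mulr_ge0.
have [e e0|x ux] := @real_cauchy_cvg R (fun m => complex.Re (u m)).
  have [N hN] := hu _ e0; exists N => m p Nm Np.
  apply: le_lt_trans (hN _ _ Nm Np); apply: le_trans (abs_ge _).1.
  by case: (u m) (u p) => ? ? [].
have [e e0|y uy] := @real_cauchy_cvg R (fun m => complex.Im (u m)).
  have [N hN] := hu _ e0; exists N => m p Nm Np.
  apply: le_lt_trans (hN _ _ Nm Np); apply: le_trans (abs_ge _).2.
  by case: (u m) (u p) => ? ? [].
exists (x +i* y)%C; apply/cvg_scalarP => e e0.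
have e20 : 0 < e / 2 by rewrite divr_gt0.
have /cvgrPdist_lt/(_ _ e20) := ux; have /cvgrPdist_lt/(_ _ e20) := uy.
apply: filterS2 => m yu xu.
apply: le_lt_trans (abs_le _) _; rewrite [ltRHS]splitr.
move: yu xu; case: (u m) => ? ? /=; rewrite distrC => yu; rewrite distrC => xu.
exact: ltrD.
Qed.

(** * Coordinates and norms *)

Section Vectors.
Context {R : realType} {k : scalar_kind} {n : nat}.
Local Notation K := (scalar_field R k).
Local Notation X := ('rV[K]_n).
Implicit Types (x y : X) (c : K).

(** The estimates run through the sum norm, whose triangle inequality follows coordinate by
    coordinate. It lies between [hnorm] and [n%:R * hnorm]. *)
Definition norm1 x : R := \sum_(j < n) scalar_abs (x 0 j).

Lemma norm1_ge0 x : 0 <= norm1 x.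
Proof. by apply: sumr_ge0 => j _; exact: scalar_abs_ge0. Qed.

Lemma norm1_0 : norm1 0 = 0.
Proof. by apply: big1 => j _; rewrite mxE scalar_abs0. Qed.

Lemma norm1D x y : norm1 (x + y) <= norm1 x + norm1 y.
Proof.
by rewrite -big_split; apply: ler_sum => j _; rewrite mxE scalar_absD.
Qed.

Lemma norm1B x y : norm1 (x - y) = norm1 (y - x).
Proof. by apply: eq_bigr => j _; rewrite !mxE scalar_absB. Qed.

Lemma norm1_triangle x y z : norm1 (x - z) <= norm1 (x - y) + norm1 (y - z).
Proof. by rewrite -[x - z](subrKA y) norm1D. Qed.

Lemma norm1Z c x : norm1 (c *: x) = scalar_abs c * norm1 x.
Proof.
by rewrite mulr_sumr; apply: eq_bigr => j _; rewrite mxE scalar_absM.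
Qed.

Lemma norm1_sum (I : finType) (F : I -> X) :
  norm1 (\sum_i F i) <= \sum_i norm1 (F i).
Proof.
elim/big_ind2: _ => [|u x v y ux vy|//]; first by rewrite norm1_0.
exact: le_trans (norm1D _ _) (lerD ux vy).
Qed.

Lemma scalar_abs_le_norm1 x j : scalar_abs (x 0 j) <= norm1 x.
Proof.
by rewrite /norm1 (bigD1 j)//= lerDl sumr_ge0// => i _; exact: scalar_abs_ge0.
Qed.

Lemma hnormE x : hnorm x = Num.sqrt (\sum_(j < n) scalar_abs (x 0 j) ^+ 2).
Proof.
congr Num.sqrt; rewrite /inner scalar_re_sum.
by apply: eq_bigr => j _; rewrite mulr_scalar_conj.
Qed.

Lemma hnorm_ge0 x : 0 <= hnorm x.
Proof. exact: sqrtr_ge0. Qed.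

Lemma scalar_abs_le_hnorm x j : scalar_abs (x 0 j) <= hnorm x.
Proof.
rewrite hnormE -[leLHS]ger0_norm ?scalar_abs_ge0// -sqrtr_sqr.
rewrite ler_sqrt; last first.
  by apply: sumr_ge0 => i _; exact: sqr_ge0.
by rewrite (bigD1 j)//= lerDl sumr_ge0// => i _; exact: sqr_ge0.
Qed.

Lemma hnorm_le_norm1 x : hnorm x <= norm1 x.
Proof.
rewrite hnormE -[leRHS]ger0_norm ?norm1_ge0// -sqrtr_sqr ler_sqrt ?sqr_ge0//.
rewrite expr2 {1}/norm1 mulr_suml; apply: ler_sum => j _.
by rewrite expr2 ler_wpM2l ?scalar_abs_ge0 ?scalar_abs_le_norm1.
Qed.

Lemma norm1_le_hnorm x : norm1 x <= n%:R * hnorm x.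
Proof.
rewrite mulr_natl -[X in _ *+ X]card_ord -sumr_const.
by apply: ler_sum => j _; exact: scalar_abs_le_hnorm.
Qed.

Lemma hnormZ c x : hnorm (c *: x) = scalar_abs c * hnorm x.
Proof.
rewrite !hnormE -[X in X * _]ger0_norm ?scalar_abs_ge0// -sqrtr_sqr.
rewrite -sqrtrM ?sqr_ge0//; congr Num.sqrt; rewrite mulr_sumr.
by apply: eq_bigr => j _; rewrite mxE scalar_absM exprMn.
Qed.

Lemma hnorm0 : hnorm (0 : X) = 0.
Proof. by rewrite -(scale0r 0) hnormZ scalar_abs0 mul0r. Qed.

Lemma inner_linearl y : linear_for *%R (inner^~ y).
Proof.
move=> c x x'; rewrite /inner mulr_sumr -big_split; apply: eq_bigr => j _ /=.
by rewrite !mxE mulrDl mulrA.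
Qed.

Lemma innerDl x x' y : inner (x + x') y = inner x y + inner x' y.
Proof. by have := inner_linearl y 1 x x'; rewrite scale1r mul1r. Qed.

Lemma inner0l y : inner 0 y = 0.
Proof. by apply: big1 => j _; rewrite mxE mul0r. Qed.

Lemma innerZl c x y : inner (c *: x) y = c * inner x y.
Proof. by have := inner_linearl y c x 0; rewrite addr0 inner0l addr0. Qed.

Lemma inner_suml (I : finType) (P : pred I) (F : I -> X) y :
  inner (\sum_(i | P i) F i) y = \sum_(i | P i) inner (F i) y.
Proof.
elim/big_ind2: _ => [|x z x' z' <- <-|//]; [exact: inner0l|exact: innerDl].
Qed.

Lemma inner0r x : inner x 0 = 0.
Proof. by apply: big1 => j _; rewrite mxE scalar_conj0 mulr0. Qed.

Lemma innerDr x y y' : inner x (y + y') = inner x y + inner x y'.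
Proof.
rewrite /inner -big_split; apply: eq_bigr => j _ /=.
by rewrite mxE scalar_conjD mulrDr.
Qed.

Lemma innerBr x y y' : inner x (y - y') = inner x y - inner x y'.
Proof.
rewrite /inner -sumrB; apply: eq_bigr => j _ /=.
by rewrite !mxE scalar_conjB mulrBr.
Qed.

Lemma inner_sumr (I : finType) (P : pred I) (F : I -> X) x :
  inner x (\sum_(i | P i) F i) = \sum_(i | P i) inner x (F i).
Proof.
elim/big_ind2: _ => [|y z y' z' <- <-|//]; [exact: inner0r|exact: innerDr].
Qed.

Lemma scalar_abs_inner x y : scalar_abs (inner x y) <= norm1 x * hnorm y.
Proof.
rewrite /norm1 mulr_suml; apply: le_trans (scalar_abs_sum _) _.
apply: ler_sum => j _; rewrite scalar_absM scalar_abs_conj.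
by rewrite ler_wpM2l ?scalar_abs_ge0 ?scalar_abs_le_hnorm.
Qed.

Lemma cvg_rowP (U : Type) (F : set_system U) {FF : Filter F} (f : U -> X) x :
  f @ F --> x <->
  forall e : R, 0 < e -> \forall u \near F, norm1 (f u - x) < e.
Proof.
split=> [/cvg_ballP h e e0|h]; last first.
  apply/cvg_ballP => e e0; have [r r0 ->] := scalar_gt0P e0.
  apply: filterS (h _ r0) => u fux; split=> [|i j].
    by rewrite -scalar_of_real0 ltr_scalar_of_real.
  rewrite -ball_normE /= normr_scalar ltr_scalar_of_real (ord1 i) scalar_absB.
  apply: le_lt_trans fux; apply: le_trans (scalar_abs_le_norm1 _ j).
  by rewrite !mxE.
(* The denominator [n.+1] is positive for every [n], and [n] errors of this size add up to strictly
   less than [e]. *)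
have e'0 : 0 < e / n.+1%:R by rewrite divr_gt0.
have := h (scalar_of_real (e / n.+1%:R)).
rewrite -scalar_of_real0 ltr_scalar_of_real => /(_ e'0).
apply: filterS => u [_ fux].
apply: (@le_lt_trans _ _ (\sum_(j < n) e / n.+1%:R)).
  apply: ler_sum => j _; have := fux 0 j; rewrite -ball_normE /=.
  by rewrite normr_scalar ltr_scalar_of_real !mxE scalar_absB => /ltW.
rewrite sumr_const card_ord -[X in X < _]mulr_natl mulrCA gtr_pMr//.
by rewrite ltr_pdivrMr// mul1r ltr_nat.
Qed.

End Vectors.

(** * Finite additivity and integrals of simple functions *)

Lemma cvg_at_unique (K : numFieldType) (V : pseudoMetricNormedZmodType K)
    (U : Type) (F : set_system U) {FF : ProperFilter F} (f : U -> V) (x y : V) :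
  f @ F --> y -> f @ F --> x -> x = y.
Proof. by move=> fy fx; exact: (cvg_unique (@norm_hausdorff _ V) fx fy). Qed.

Section FiniteAdditivity.
Context {R : realType} {k : scalar_kind} {n : nat} {T : metricType R}.
Local Notation K := (scalar_field R k).
Local Notation X := ('rV[K]_n).
Implicit Types (mu nu : set T -> X) (A : set T).

Lemma borel_open A : open A -> borel A.
Proof. by move=> oA; apply: sub_sigma_algebra. Qed.

Lemma borel0 : borel (set0 : set T).
Proof. by apply: borel_open; exact: open0. Qed.

Lemma borelC A : borel A -> borel (~` A).
Proof. by move=> bA; rewrite -setTD; exact: sigma_algebraCD. Qed.

(** A finite family is padded with empty sets to a sequence, the form in which countable additivity
    is stated. *)
Definition nat_family (I : finType) (F : I -> set T) (m : nat) : set T :=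
  oapp (fun j : 'I_#|I| => F (enum_val j)) set0 (insub m).

Lemma nat_familyE (I : finType) (F : I -> set T) (j : 'I_#|I|) :
  nat_family F j = F (enum_val j).
Proof. by rewrite /nat_family valK. Qed.

Lemma bigcup_nat_family (I : finType) (F : I -> set T) :
  \bigcup_m nat_family F m = \bigcup_i F i.
Proof.
apply/seteqP; split=> t [m _].
  by rewrite /nat_family; case: insubP => //= j _ _ Ft; exists (enum_val j).
move=> Ft; exists (enum_rank m : nat) => //.
by rewrite nat_familyE enum_rankK.
Qed.

Lemma borel_nat_family (I : finType) (F : I -> set T) m :
  (forall i, borel (F i)) -> borel (nat_family F m).
Proof.
by move=> bF; rewrite /nat_family; case: insub => //=; exact: borel0.
Qed.

Lemma trivIset_nat_family (I : finType) (F : I -> set T) :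
  trivIset setT F -> trivIset setT (nat_family F).
Proof.
move=> tF i j _ _ [t []]; rewrite /nat_family.
case: insubP => //= i' _ <- Fi; case: insubP => //= j' _ <- Fj.
by congr nat_of_ord; apply: enum_val_inj; apply: tF => //; exists t.
Qed.

Lemma borel_bigcup (I : finType) (F : I -> set T) :
  (forall i, borel (F i)) -> borel (\bigcup_i F i).
Proof.
move=> bF; rewrite -bigcup_nat_family; apply: sigma_algebra_bigcup => m.
exact: borel_nat_family.
Qed.

Lemma borel_bigcap (I : finType) (F : I -> set T) :
  (forall i, borel (F i)) -> borel (\bigcap_i F i).
Proof.
move=> bF; rewrite -[X in borel X]setCK setC_bigcap; apply: borelC.
by apply: borel_bigcup => i; apply: borelC.
Qed.

(** For the constant sequence of empty sets the partial sums tend to [mu set0], while their shift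
    tends to [mu set0 + mu set0]. *)
Lemma vsigma_additive0 mu : vsigma_additive mu -> mu set0 = 0.
Proof.
move=> /(_ (fun=> set0)) h.
have {h} := h (fun=> borel0) (@trivIset_set0 _ _ _).
rewrite bigcup0// => h.
suff : mu set0 + mu set0 = mu set0.
  by move=> /(congr1 (fun z => z - mu set0)); rewrite addrK subrr.
apply: (cvg_at_unique h); rewrite -cvg_shiftS.
rewrite (_ : [sequence _]_m = fun m => \sum_(i < m) mu set0 + mu set0).
  exact: cvgD h (cvg_cst _).
by apply/funext => m; rewrite /= big_ord_recr.
Qed.

Lemma vsigma_additive_fin mu (I : finType) (F : I -> set T) :
  vsigma_additive mu -> (forall i, borel (F i)) -> trivIset setT F ->
  mu (\bigcup_i F i) = \sum_i mu (F i).
Proof.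
move=> mua bF tF.
have := mua _ (fun m => borel_nat_family m bF) (trivIset_nat_family tF).
rewrite bigcup_nat_family => h.
apply/esym; apply: (cvg_at_unique h).
(* From index [#|I|] on, all further terms are [mu set0 = 0], so the partial sums are constant. *)
apply: cvg_near_cst; exists #|I| => // N /= IN.
rewrite [RHS](reindex (@enum_val I I)) /=; last exact/onW_bij/enum_val_bij.
rewrite [RHS](eq_bigr (fun j : 'I_#|I| => mu (nat_family F j))); last first.
  by move=> j _; rewrite nat_familyE.
rewrite [RHS](big_ord_widen N (fun j => mu (nat_family F j)) IN).
rewrite [RHS]big_mkcond.
apply: eq_bigr => i _; case: ifPn => // iI.
by rewrite /nat_family insubN//= vsigma_additive0.
Qed.

Lemma vvariation_fin mu (I : finType) (F : I -> set T) a :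
  (forall i, borel (F i)) -> trivIset setT F -> \bigcup_i F i = setT ->
  (vvariation mu setT <= a%:E)%E -> \sum_i hnorm (mu (F i)) <= a.
Proof.
move=> bF tF FT; rewrite -lee_fin; apply: le_trans.
apply: ereal_sup_ubound; exists #|I|, (F \o enum_val); split => //=.
- by move=> i j _ _ Fij; apply: enum_val_inj; apply: tF.
- rewrite -FT; apply/seteqP; split=> t [j _ Fj]; first by exists (enum_val j).
  by exists (enum_rank j) => //=; rewrite enum_rankK.
- by rewrite (reindex (@enum_val I I)) //=; exact/onW_bij/enum_val_bij.
Qed.

(** * Atoms of a finite family of sets *)

Section Atoms.
Context {I : finType} (F : I -> set T).

(** Replacing the possibly overlapping sets [F i] by this partition makes the variation applicable
    to them. *)
Definition atom (J : {set I}) : set T :=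
  \bigcap_i (if i \in J then F i else ~` F i).

Lemma atomP J t : atom J t <-> J = [set i | `[< F i t >]]%SET.
Proof.
split=> [Jt|-> i _]; last by rewrite inE; case: asboolP.
apply/setP => i; rewrite inE; have := Jt i Logic.I; case: ifP => // _ Fit.
  by apply/esym/asboolP.
by apply/esym/asboolP.
Qed.

Lemma borel_atom J : (forall i, borel (F i)) -> borel (atom J).
Proof.
by move=> bF; apply: borel_bigcap => i; case: ifP => // _; exact: borelC.
Qed.

Lemma trivIset_atom : trivIset setT atom.
Proof. by move=> J J' _ _ [t [/atomP -> /atomP ->]]. Qed.

Lemma bigcup_atom : \bigcup_J atom J = setT.
Proof.
apply/seteqP; split => // t _.
by exists [set i | `[< F i t >]]%SET => //; exact/atomP.
Qed.

(** Empty sets stand in for the atoms outside [F i], so that the union runs over a whole finite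
    type, as in [vsigma_additive_fin]. *)
Lemma bigcup_atom_in i :
  \bigcup_(J : {set I}) (if i \in J then atom J else set0) = F i.
Proof.
apply/seteqP; split=> t.
  move=> [J _]; case: ifP => [iJ /atomP JE|_ []].
  by move: iJ; rewrite JE inE => /asboolP.
move=> Fit; exists [set i | `[< F i t >]]%SET => //.
by rewrite inE asboolT//; exact/atomP.
Qed.

Lemma vmeasure_atoms mu i : vsigma_additive mu -> (forall i, borel (F i)) ->
  mu (F i) = \sum_(J : {set I} | i \in J) mu (atom J).
Proof.
move=> mua bF; rewrite -{1}(bigcup_atom_in i) vsigma_additive_fin//.
- rewrite [RHS]big_mkcond; apply: eq_bigr => J _; case: ifP => // _.
  exact: vsigma_additive0.
- by move=> J; case: ifP => _; [exact: borel_atom|exact: borel0].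
- move=> J J' _ _ [t]; case: ifP => _; case: ifP => _ [] // JJ J't.
  by apply: trivIset_atom => //; exists t.
Qed.

End Atoms.

(* Additivity rewrites the integral as a sum over the atoms of the Boolean
   algebra generated by the sets of [s], and on an atom [simple_eval s] is
   constant. *)
Lemma simple_integral_le mu a (s : @simple_expr R k n T) c :
  cabv_ball a mu -> 0 <= c -> (forall t, norm1 (simple_eval s t) <= c) ->
  scalar_abs (simple_integral mu s) <= c * a.
Proof.
move=> [[mus _] mua] c0 sc; have bs := @se_borel _ _ _ _ s.
pose F := @se_set _ _ _ _ s; pose x := @se_val _ _ _ _ s.
have -> : simple_integral mu s =
    \sum_(J : {set 'I_(se_len s)}) inner (\sum_(i in J) x i) (mu (atom F J)).
  rewrite /simple_integral.
  under eq_bigr do rewrite (vmeasure_atoms _ mus bs) inner_sumr big_mkcond.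
  rewrite exchange_big; apply: eq_bigr => J _ /=.
  by rewrite inner_suml [RHS]big_mkcond.
apply: le_trans (scalar_abs_sum _) _.
apply: (@le_trans _ _ (\sum_J c * hnorm (mu (atom F J)))).
  apply: ler_sum => J _; apply: le_trans (scalar_abs_inner _ _) _.
  (* An empty atom contributes 0; in a nonempty one, any point [t] realises the vector
     [\sum_(i in J) x i] as a value of [s], which [c] bounds. *)
  have [[t Jt]|] := pselect (atom F J !=set0); last first.
    move=> /set0P/negP/negPn/eqP ->.
    by rewrite vsigma_additive0// hnorm0 !mulr0.
  rewrite ler_wpM2r ?hnorm_ge0//; apply: le_trans (sc t).
  rewrite le_eqVlt; apply/orP; left; apply/eqP; congr norm1.
  rewrite big_mkcond; apply: eq_bigr => i _.
  move/atomP: Jt => ->; rewrite inE indicE.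
  case: asboolP => Fit; first by rewrite mem_set// scale1r.
  by rewrite memNset// scale0r.
rewrite -mulr_sumr ler_wpM2l//; apply: vvariation_fin mua.
- by move=> J; exact: borel_atom.
- exact: trivIset_atom.
- exact: bigcup_atom.
Qed.

(** The partition of the space into a single piece gives [hnorm (mu setT) <= a]. *)
Lemma cabv_ball_ge0 a mu : cabv_ball a mu -> 0 <= a.
Proof.
move=> [_ mua].
have := @vvariation_fin mu unit (fun=> setT) a _ _ _ mua.
rewrite big_const card_unit /= => h.
apply: le_trans (h _ _ _).
- by rewrite addr_ge0 ?hnorm_ge0.
- by move=> _; by apply: borel_open; exact: openT.
- by move=> [] [].
- by apply/seteqP; split => // t _; exists tt.
Qed.

End FiniteAdditivity.

(** * The integral *)

Section Integral.
Context {R : realType} {k : scalar_kind} {n : nat} {T : metricType R}.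
Local Notation K := (scalar_field R k).
Local Notation X := ('rV[K]_n).
Local Notation simple := (@simple_expr R k n T).
Implicit Types (mu nu : set T -> X) (s : nat -> simple) (f g : T -> X).

Lemma converges_uniformlyP s f : converges_uniformly s f <->
  forall e : R, 0 < e ->
    \forall m \near \oo, forall t, norm1 (simple_eval (s m) t - f t) < e.
Proof.
split=> h e e0; last first.
  apply: filterS (h _ e0) => m hm t.
  by apply: le_lt_trans (hm t); exact: hnorm_le_norm1.
have e'0 : 0 < e / n.+1%:R by rewrite divr_gt0.
apply: filterS (h _ e'0) => m hm t; apply: le_lt_trans (norm1_le_hnorm _) _.
apply: (@le_lt_trans _ _ (n%:R * (e / n.+1%:R))).
  by rewrite ler_wpM2l// ltW.
by rewrite mulrCA gtr_pMr// ltr_pdivrMr// mul1r ltr_nat.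
Qed.

Lemma simple_lin_borel (u v : simple) (i : 'I_(se_len u + se_len v)) :
  borel (match fintype.split i with
         | inl j => @se_set _ _ _ _ u j | inr j => @se_set _ _ _ _ v j end).
Proof. by case: fintype.split => j; exact: se_borel. Qed.

(** The sets of an expression may overlap, so concatenation represents the linear combination. *)
Definition simple_lin (c : K) (u v : simple) : simple :=
  SimpleExpr (fun i => match fintype.split i with
      inl j => c *: @se_val _ _ _ _ u j | inr j => @se_val _ _ _ _ v j end)
    (@simple_lin_borel u v).

Lemma simple_eval_lin c (u v : simple) t :
  simple_eval (simple_lin c u v) t = c *: simple_eval u t + simple_eval v t.
Proof.
rewrite {1}/simple_eval big_split_ord scaler_sumr /=; congr (_ + _).
  by apply: eq_bigr => i _; rewrite (unsplitK (inl i)) scalerA mulrC -scalerA.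
by apply: eq_bigr => i _; rewrite (unsplitK (inr i)).
Qed.

Lemma simple_integral_lin mu c (u v : simple) :
  simple_integral mu (simple_lin c u v) =
  c * simple_integral mu u + simple_integral mu v.
Proof.
rewrite {1}/simple_integral big_split_ord mulr_sumr /=; congr (_ + _).
  by apply: eq_bigr => i _; rewrite (unsplitK (inl i)) innerZl.
by apply: eq_bigr => i _; rewrite (unsplitK (inr i)).
Qed.

Lemma simple_integralB mu nu (u : simple) :
  simple_integral (mu \- nu) u = simple_integral mu u - simple_integral nu u.
Proof.
by rewrite /simple_integral -sumrB; apply: eq_bigr => i _; rewrite innerBr.
Qed.

Lemma converges_uniformly_lin c s s' f g :
  converges_uniformly s f -> converges_uniformly s' g ->
  converges_uniformly (fun m => simple_lin c (s m) (s' m))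
    (fun t => c *: f t + g t).
Proof.
move=> /converges_uniformlyP sf /converges_uniformlyP sg.
apply/converges_uniformlyP => e e0.
(* Adding 1 keeps the denominator of the tolerance for [s] positive when [c] is 0. *)
have c0 : 0 < 2 * (scalar_abs c + 1).
  by rewrite mulr_gt0// ltr_wpDl ?scalar_abs_ge0.
have e20 : 0 < e / 2 by rewrite divr_gt0.
have ec0 : 0 < e / (2 * (scalar_abs c + 1)) by rewrite divr_gt0.
apply: filterS2 (sf _ ec0) (sg _ e20) => m sfm sgm t.
rewrite simple_eval_lin opprD addrACA -scalerBr.
apply: le_lt_trans (norm1D _ _) _; rewrite [ltRHS]splitr.
apply: ler_ltD (sgm t); rewrite norm1Z.
apply: (@le_trans _ _ ((scalar_abs c + 1) * (e / (2 * (scalar_abs c + 1))))).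
  by apply: ler_pM; rewrite ?scalar_abs_ge0 ?norm1_ge0// ?lerDl// ltW.
rewrite invfM [X in _ * X]mulrA mulrC divfK//.
by rewrite gt_eqF// ltr_wpDl ?scalar_abs_ge0.
Qed.

(** The difference of two approximations is a uniformly small simple function. With [s' = s] this is
    the Cauchy property; with different sequences it shows that the limit does not depend on the
    choice. *)
Lemma simple_integral_close mu a s s' f e :
  cabv_ball a mu -> converges_uniformly s f -> converges_uniformly s' f ->
  0 < e -> exists N, forall m p, (N <= m)%N -> (N <= p)%N ->
    scalar_abs (simple_integral mu (s m) - simple_integral mu (s' p)) < e.
Proof.
move=> mua /converges_uniformlyP sf /converges_uniformlyP sf' e0.
have a0 := cabv_ball_ge0 mua.
(* Two such errors add up to [e / (a + 1)], and [e / (a + 1) * a < e]. *)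
have d0 : 0 < e / (2 * (a + 1)) by rewrite divr_gt0// mulr_gt0// ltr_wpDl.
have [[N _ hN] [N' _ hN']] := (sf _ d0, sf' _ d0).
exists (maxn N N') => m p; rewrite !geq_max => /andP[Nm _] /andP[_ Np].
rewrite -opprB scalar_absN addrC -mulN1r -simple_integral_lin.
apply: (@le_lt_trans _ _ (e / (a + 1) * a)); last first.
  by rewrite -mulrA gtr_pMr// mulrC ltr_pdivrMr ?ltr_wpDl// mul1r ltrDl.
apply: simple_integral_le => // [|t]; first by rewrite divr_ge0 ?ltW// ltr_wpDl.
rewrite simple_eval_lin scaleN1r addrC.
apply: le_trans (norm1_triangle _ (f t) _) _.
rewrite [norm1 (f t - _)]norm1B.
apply: le_trans (lerD (ltW (hN' _ Np t)) (ltW (hN _ Nm t))) _.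
by rewrite invfM mulrA -mulrDl -splitr.
Qed.

(** The limit along one approximating sequence is the limit along all of them, so the set under
    [xget] is inhabited and the value is a genuine limit rather than the default 0. *)
Lemma vintegral_cvg mu a s f : cabv_ball a mu -> converges_uniformly s f ->
  simple_integral mu (s m) @[m --> \oo] --> vintegral mu f.
Proof.
move=> mua sf; rewrite /vintegral; set P := [set l : K | _].
suff /(xgetPex 0)[_] : exists l, P l by apply.
have [e e0|l ul] := @scalar_cauchy_cvg R k (fun m => simple_integral mu (s m)).
  exact: (simple_integral_close mua sf sf e0).
exists l; split=> [|s' sf']; first by exists s.
apply/cvg_scalarP => e e0; have e20 : 0 < e / 2 by rewrite divr_gt0.
have [N hN] := simple_integral_close mua sf' sf e20.
have /cvg_scalarP/(_ _ e20) := ul.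
apply: filterS2 (nbhs_infty_ge N) => m Nm ulm.
rewrite -(subrKA (simple_integral mu (s m))).
by apply: le_lt_trans (scalar_absD _ _) _; rewrite [ltRHS]splitr ltrD ?hN.
Qed.

(** Simple integrals are additive in the measure, so the difference of the two integrals belongs to
    the set that defines [vintegral (mu \- nu) f]; uniqueness of limits identifies it with the
    chosen element. *)
Lemma vintegralB mu nu a s f : cabv_ball a mu -> cabv_ball a nu ->
  converges_uniformly s f ->
  vintegral (mu \- nu) f = vintegral mu f - vintegral nu f.
Proof.
move=> mua nua sf; rewrite {1}/vintegral; set P := [set l : K | _].
have cvgP s' : converges_uniformly s' f ->
    simple_integral (mu \- nu) (s' m) @[m --> \oo] -->
    vintegral mu f - vintegral nu f.
  move=> sf'; under eq_fun do rewrite simple_integralB.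
  exact: (cvgB (vintegral_cvg mua sf') (vintegral_cvg nua sf')).
have /(xgetPex 0)[_ h] : exists l, P l.
  by exists (vintegral mu f - vintegral nu f); split=> //; exists s.
exact: (cvg_at_unique (cvgP _ sf) (h _ sf)).
Qed.

Lemma vintegral_lin mu a c s s' f g : cabv_ball a mu ->
  converges_uniformly s f -> converges_uniformly s' g ->
  vintegral mu (fun t => c *: f t + g t) = c * vintegral mu f + vintegral mu g.
Proof.
move=> mua sf sg.
have := vintegral_cvg mua (converges_uniformly_lin c sf sg).
under eq_fun do rewrite simple_integral_lin.
move=> h; apply: (cvg_at_unique _ h).
exact: (cvgD (cvgM (cvg_cst c) (vintegral_cvg mua sf)) (vintegral_cvg mua sg)).
Qed.

Lemma vintegral_le mu a s f c : cabv_ball a mu -> converges_uniformly s f ->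
  (forall t, norm1 (f t) <= c) -> 0 <= c ->
  scalar_abs (vintegral mu f) <= c * a.
Proof.
move=> mua sf fc c0; have a0 := cabv_ball_ge0 mua.
apply/ler_addgt0Pr => e e0.
(* Writing d for this tolerance, the final bound is [d + (c + d) * a = c * a + e]. *)
have d0 : 0 < e / (a + 1) by rewrite divr_gt0// ltr_wpDl.
have /converges_uniformlyP/(_ _ d0) := sf.
have /cvg_scalarP/(_ _ d0) := vintegral_cvg mua sf.
move=> h1 h2; have [m [im sm]] := filter_ex (filterI h1 h2).
rewrite -[X in scalar_abs X](subrK (simple_integral mu (s m))).
apply: le_trans (scalar_absD _ _) _.
rewrite scalar_absB.
apply: (@le_trans _ _ (e / (a + 1) + (c + e / (a + 1)) * a)); last first.
  rewrite mulrDl addrCA -{1}[e / (a + 1)]mulr1 -mulrDr [1 + a]addrC divfK//.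
  by rewrite gt_eqF// ltr_wpDl.
apply: lerD (ltW im) _; apply: simple_integral_le => // [|t].
  by rewrite addr_ge0// ltW.
rewrite -[X in norm1 X](subrK (f t)) addrC.
apply: le_trans (norm1D _ _) _.
exact: (lerD (fc t) (ltW (sm t))).
Qed.

End Integral.

(** * Compact metric spaces *)

Section CompactMetric.
Context {R : realType} {T : metricType R}.
Context (T_compact : compact [set: T]).

Lemma open_mdist_ball (t : T) (d : R) : open [set x | mdist t x < d].
Proof.
rewrite openE => x /= tx; apply/nbhs_ballP; exists (d - mdist t x) => /=.
  by rewrite subr_gt0.
move=> y; rewrite ballEmdist /= ltrBrDl; apply: le_lt_trans.
exact: metric_triangle.
Qed.

(** Near-covering compactness is applied to finite lists of centres filtered by inclusion: around
    each [x] every list containing [x] works, so some list works everywhere. *)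
Lemma finite_net (d : R) : 0 < d ->
  exists (q : nat) (t : 'I_q -> T), forall x, exists i, mdist (t i) x < d.
Proof.
move=> d0; pose F := filter_from [set: seq T]
  (fun s0 => [set s : seq T | {subset s0 <= s}]).
have FF : Filter F.
  apply: filter_from_filter; first by exists [::].
  move=> s1 s2 _ _; exists (s1 ++ s2) => // s ss.
  by split=> t ts; apply: ss; rewrite mem_cat ts ?orbT.
have /compact_near_coveringP/(_ (seq T) F
  (fun (s : seq T) x => exists2 t, t \in s & mdist t x < d) FF) := T_compact.
case=> [x _|s0 _ hs].
  exists ([set y | mdist x y < d], [set s : seq T | x \in s]); last first.
    by move=> [y s] /= [xy xs]; exists x.
  split=> /=; last by exists [:: x] => // s; apply; exact: mem_head.
  by apply: open_nbhs_nbhs; split; [exact: open_mdist_ball|rewrite /= mdistxx].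
exists (size s0), (tnth (in_tuple s0)) => x.
by have [//|t /(tnthP (in_tuple s0))[i ->] ix] := hs s0 _ x Logic.I; exists i.
Qed.

Section Valued.
Context {k : scalar_kind} {n : nat}.
Local Notation K := (scalar_field R k).
Local Notation X := ('rV[K]_n).
Implicit Types f : T -> X.

Lemma continuous_norm1P f : continuous f <->
  forall t (e : R), 0 < e -> exists2 d : R, 0 < d &
    forall s, mdist t s < d -> norm1 (f s - f t) < e.
Proof.
split=> [fc t e e0|h t].
  have /cvg_rowP/(_ _ e0)/nbhs_ballP[d /= d0 hd] := fc t.
  by exists d => // s ts; apply: hd; rewrite ballEmdist.
apply/cvg_rowP => e e0; have [d d0 hd] := h t _ e0.
by apply/nbhs_ballP; exists d => // s; rewrite ballEmdist; exact: hd.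
Qed.

Lemma lipschitz_continuous f (L : R) :
  (forall s t, norm1 (f s - f t) <= L * mdist s t) -> continuous f.
Proof.
move=> fL; apply/continuous_norm1P => t e e0.
have L0 : 0 < `|L| + 1 by rewrite ltr_wpDl.
exists (e / (`|L| + 1)); first by rewrite divr_gt0.
move=> s; rewrite ltr_pdivlMr// => ts; apply: le_lt_trans (fL s t) _.
apply: le_lt_trans ts; rewrite metric_sym mulrC ler_wpM2l ?mdist_ge0//.
by rewrite (le_trans (ler_norm _))// lerDl.
Qed.

Lemma compact_unif_continuous f (e : R) : continuous f -> 0 < e ->
  exists2 d : R, 0 < d & forall s t, mdist s t < d -> norm1 (f s - f t) < e.
Proof.
move=> /continuous_norm1P fc e0.
have e20 : 0 < e / 2 by rewrite divr_gt0.
(* The covering parameter is now the modulus [d], tending to 0 from the right. *)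
have := T_compact => /compact_near_coveringP/(_ R (0 : R)^'+
  (fun d t => forall s, mdist s t < d -> norm1 (f s - f t) < e)).
case=> [t _|d /= d0 hd]; last first.
  (* The property holds for all moduli strictly between 0 and [d], in particular for [d / 2]. *)
  exists (d / 2); first by rewrite divr_gt0.
  move=> s t st; apply: (hd (d / 2)) => //.
  - by rewrite /= sub0r normrN gtr0_norm ?divr_gt0// gtr_pMr// invf_lt1 ?ltr1n.
  - by rewrite divr_gt0.
have [d d0 hd] := fc t _ e20.
(* If [x] is within [d / 2] of [t] and [s] within [r < d / 2] of [x], both lie within [d] of [t],
   where [f] varies by less than [e / 2]. *)
exists ([set x | mdist t x < d / 2], [set r | r < d / 2]).
  split=> /=.
    apply: open_nbhs_nbhs; split; first exact: open_mdist_ball.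
    by rewrite /= mdistxx divr_gt0.
  by apply: nbhs_right_lt; rewrite divr_gt0.
move=> [x r] /= [tx rd] s sx.
apply: le_lt_trans (norm1_triangle _ (f t) _) _; rewrite [ltRHS]splitr.
apply: ltrD.
  apply: hd; apply: le_lt_trans (metric_triangle _ x _) _.
  by rewrite [ltRHS]splitr ltrD// metric_sym (lt_trans sx).
rewrite norm1B; apply: hd; apply: lt_trans tx _.
by rewrite gtr_pMr// invf_lt1 ?ltr1n.
Qed.

(** Every value is within 1 of the value at some point of a finite net, and the sum over the net
    dominates each of these. *)
Lemma compact_norm1_bounded f : continuous f ->
  exists2 M : R, 0 < M & forall t, norm1 (f t) <= M.
Proof.
move=> /compact_unif_continuous/(_ ltr01)[d d0 hd].
have [q [t tq]] := finite_net d0.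
have S0 : 0 <= \sum_i norm1 (f (t i)).
  by apply: sumr_ge0 => i _; exact: norm1_ge0.
exists (1 + \sum_i norm1 (f (t i))) => [|x]; first by rewrite ltr_pwDl.
have [i xi] := tq x; rewrite -[X in norm1 X](subrK (f (t i))).
apply: le_trans (norm1D _ _) _; apply: lerD.
  by apply/ltW/hd; rewrite metric_sym.
by rewrite (bigD1 i)//= lerDl sumr_ge0// => j _; exact: norm1_ge0.
Qed.

Lemma simple_approx f (e : R) : continuous f -> 0 < e ->
  exists s : @simple_expr R k n T, forall t, norm1 (simple_eval s t - f t) < e.
Proof.
move=> fc e0; have [d d0 hd] := compact_unif_continuous fc e0.
have [q [c cq]] := finite_net d0.
pose B i := [set x | mdist (c i) x < d].
(* [A i] is the ball [B i] minus all earlier balls, so a point lies only in the set of the first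
   ball that contains it. *)
pose A (i : 'I_q) := \bigcap_(j : 'I_q)
  (if (j < i)%N then ~` B j else if j == i then B i else setT).
have bB i : borel (B i) by apply: borel_open; exact: open_mdist_ball.
have bA i : borel (A i).
  apply: borel_bigcap => j; case: ifP => _; first exact: borelC.
  by case: ifP => _ //; apply: borel_open; exact: openT.
exists (SimpleExpr (fun i => f (c i)) bA) => t.
have [i0 ti0] := cq t.
have hi0 : `[< B i0 t >] by exact/asboolP.
case: (@arg_minnP _ i0 (fun i => `[< B i t >]) val hi0) => i /asboolP Bit imin.
have AE j : \1_(A j) t = (j == i)%:R :> K.
  rewrite indicE; congr (nat_of_bool _)%:R.
  apply/idP/eqP => [/set_mem Ajt|->].
    have := Ajt j Logic.I; rewrite ltnn eqxx => /asboolP/imin ij.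
    apply/val_inj/eqP; rewrite eqn_leq ij andbT leqNgt; apply/negP => ij'.
    by have := Ajt i Logic.I; rewrite ij'.
  apply: mem_set => l _; case: ifPn => li; last by case: eqP => // ->.
  by move=> /asboolP/imin; rewrite leqNgt li.
rewrite /simple_eval (bigD1 i)//= big1 ?addr0 => [|j /negPf ji].
  by rewrite AE eqxx scale1r; exact: hd.
by rewrite AE ji scale0r.
Qed.

Lemma continuous_converges_uniformly f : continuous f ->
  exists s : nat -> @simple_expr R k n T, converges_uniformly s f.
Proof.
move=> fc.
have /choice[s hs] : forall m : nat, exists s : @simple_expr R k n T,
    forall t, norm1 (simple_eval s t - f t) < m.+1%:R^-1.
  by move=> m; apply: simple_approx.
exists s; apply/converges_uniformlyP => e e0.
apply: filterS (near_infty_natSinv_lt (PosNum e0)) => m me t.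
exact: lt_trans (hs m t) me.
Qed.

End Valued.

(* Normalised tent functions supported near the points of a net. *)
Lemma lipschitz_partition_of_unity (d : R) : 0 < d ->
  exists (q : nat) (c : 'I_q -> T) (w : 'I_q -> T -> R) (L : R),
  [/\ forall i x, 0 <= w i x, forall x, \sum_i w i x = 1,
      forall i x, d <= mdist (c i) x -> w i x = 0
    & forall i x y, `|w i x - w i y| <= L * mdist x y].
Proof.
move=> d0; have d20 : 0 < d / 2 by rewrite divr_gt0.
have [q [c cq]] := finite_net d20.
pose phi i x := Num.max 0 (d - mdist (c i) x).
pose S x := \sum_i phi i x.
have phi0 i x : 0 <= phi i x by rewrite le_max lexx.
(* The net has radius [d / 2] but the tents have radius [d], so some tent has height at least
   [d / 2] at [x]; this keeps the denominators away from 0. *)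
have S_gt x : d / 2 <= S x.
  have [i ix] := cq x; rewrite /S (bigD1 i)//=.
  apply: ler_wpDr; first exact: sumr_ge0.
  by rewrite /phi le_max lerBrDr -lerBrDl {2}[d]splitr addrK (ltW ix) orbT.
have S0 x : 0 < S x by exact: lt_le_trans (S_gt x).
have phiL i x y : `|phi i x - phi i y| <= mdist x y.
  have tri z z' : phi i z <= phi i z' + mdist z z'.
    rewrite ge_max addr_ge0 ?mdist_ge0//=.
    apply: (@le_trans _ _ (d - mdist (c i) z' + mdist z z')).
      by have := metric_triangle (c i) z z'; lra.
    by rewrite lerD2r le_max lexx orbT.
  rewrite ler_norml lerBlDl tri andbT lerBrDl lerBlDr.
  by rewrite metric_sym tri.
have SL x y : `|S x - S y| <= q%:R * mdist x y.
  rewrite /S -sumrB; apply: le_trans (ler_norm_sum _ _ _) _.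
  rewrite mulr_natl -[X in _ *+ X]card_ord -sumr_const.
  exact: ler_sum.
(* In the Lipschitz constant, 1 comes from the tent and [q%:R] from [S], both divided by the lower
   bound of [S]. *)
exists q, c, (fun i x => phi i x / S x), ((1 + q%:R) / (d / 2)); split.
- by move=> i x; exact: (divr_ge0 (phi0 i x) (ltW (S0 x))).
- by move=> x; rewrite -mulr_suml divff// gt_eqF ?S0.
- by move=> i x dx; rewrite /phi max_l ?mul0r// subr_le0.
move=> i x y.
have -> : phi i x / S x - phi i y / S y =
    (phi i x - phi i y) / S x + (phi i y / S y) * ((S y - S x) / S x).
  by field; rewrite !gt_eqF ?S0.
apply: le_trans (ler_normD _ _) _.
rewrite !normrM !normfV !(gtr0_norm (S0 _)) mulrDl mul1r mulrDl.
have iS : (S x)^-1 <= (d / 2)^-1 by rewrite lef_pV2 ?posrE ?S0 ?S_gt.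
apply: lerD.
  by rewrite mulrC ler_pM ?invr_ge0 ?(ltW (S0 _)) ?phiL.
rewrite ger0_norm// -[leRHS]mul1r; apply: ler_pM => //.
- exact: (divr_ge0 (phi0 _ _) (ltW (S0 _))).
- by rewrite divr_ge0// ltW ?S0.
- by rewrite ler_pdivrMr ?S0// mul1r /S (bigD1 i)//= lerDl sumr_ge0.
- by rewrite [leRHS]mulrAC distrC ler_pM// invr_ge0 ltW ?S0.
Qed.

End CompactMetric.

(** * The Monge-Kantorovich norm *)

Section BoundedLipschitz.
Context {R : realType} {k : scalar_kind} {n : nat} {T : metricType R}.
Local Notation K := (scalar_field R k).
Local Notation X := ('rV[K]_n).
Implicit Types f g : T -> X.
Context (T_compact : compact [set: T]).

(** For distinct points the difference quotient is a lower bound of all Lipschitz constants, hence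
    at most their infimum. *)
Lemma hnorm_lip_norm f s t : lipschitz_fun f ->
  hnorm (f s - f t) <= lip_norm f * mdist s t.
Proof.
move=> fl; have [->|st] := eqVneq s t.
  by rewrite subrr hnorm0 mdistxx mulr0.
rewrite -ler_pdivrMr ?mdist_gt0//; apply: lb_le_inf => // L [_ fL].
by rewrite ler_pdivrMr ?mdist_gt0.
Qed.

Lemma lip_norm_ge0 f : lipschitz_fun f -> 0 <= lip_norm f.
Proof. by move=> fl; apply: lb_le_inf => // L []. Qed.

Lemma lipschitz_fun_continuous f : lipschitz_fun f -> continuous f.
Proof.
move=> [L [L0 fL]]; apply: (@lipschitz_continuous _ _ _ _ _ (n%:R * L)) => s t.
apply: le_trans (norm1_le_hnorm _) _; rewrite -mulrA.
by rewrite ler_wpM2l.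
Qed.

Lemma hnorm_sup_norm f t : continuous f -> hnorm (f t) <= sup_norm f.
Proof.
move=> /(compact_norm1_bounded T_compact)[M _ fM].
apply: ub_le_sup; last by exists t.
by exists M => _ [s _ <-]; exact: le_trans (hnorm_le_norm1 _) (fM s).
Qed.

Lemma BL1_continuous f : BL1 f -> continuous f.
Proof. by case=> /lipschitz_fun_continuous. Qed.

Lemma BL1_hnorm f t : BL1 f -> hnorm (f t) <= 1.
Proof.
move=> [fl f1]; apply: le_trans f1.
apply: le_trans (hnorm_sup_norm t (lipschitz_fun_continuous fl)) _.
by rewrite lerDl lip_norm_ge0.
Qed.

Lemma BL1_lipschitz f s t : BL1 f -> hnorm (f s - f t) <= mdist s t.
Proof.
move=> [fl f1]; apply: le_trans (hnorm_lip_norm s t fl) _.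
rewrite -[leRHS]mul1r ler_wpM2r ?mdist_ge0//; apply: le_trans f1.
rewrite lerDr; apply: le_trans (hnorm_ge0 (f s)) _.
exact: hnorm_sup_norm (lipschitz_fun_continuous fl).
Qed.

Lemma BL1_intro f (M L : R) : [set: T] !=set0 -> 0 <= L ->
  (forall t, hnorm (f t) <= M) ->
  (forall s t, hnorm (f s - f t) <= L * mdist s t) -> M + L <= 1 -> BL1 f.
Proof.
move=> [t0 _] L0 fM fL ML1; split; first by exists L.
apply: le_trans ML1; apply: lerD.
  apply: ge_sup; first by exists (hnorm (f t0)), t0.
  by move=> _ [t _ <-].
by apply: inf_lbound; [exists 0 => ? []|split].
Qed.

(** * Bounded linear functionals on continuous functions *)

(** This isolates what both implications use of integration against [mu_ m \- mu]: linearity and a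
    bound [b] that can be common to all [m]. *)
Definition bounded_functional (b : R) (F : (T -> X) -> K) : Prop :=
  (forall c f g, continuous f -> continuous g ->
     F (fun t => c *: f t + g t) = c * F f + F g) /\
  (forall f c, continuous f -> 0 <= c -> (forall t, norm1 (f t) <= c) ->
     scalar_abs (F f) <= c * b).

Lemma continuous_const (x : X) : continuous (fun _ : T => x).
Proof. exact: cst_continuous. Qed.

Lemma continuous_lin c f g : continuous f -> continuous g ->
  continuous (fun t => c *: f t + g t).
Proof.
by move=> fc gc t; exact: cvgD (cvgZ (cvg_cst c) (fc t)) (gc t).
Qed.

Lemma continuous_sum (I : Type) (r : seq I) (c : I -> K) (h : I -> T -> X) :
  (forall i, continuous (h i)) ->
  continuous (fun t => \sum_(i <- r) c i *: h i t).
Proof.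
move=> hc; elim: r => [|i r ih].
  by under eq_fun do rewrite big_nil; exact: continuous_const.
by under eq_fun do rewrite big_cons; exact: continuous_lin.
Qed.

Section Functional.
Context (b : R) (F : (T -> X) -> K) (Fb : bounded_functional b F).

Lemma bounded_functional0 : F (fun=> 0) = 0.
Proof.
have := Fb.2 (fun=> 0) 0 (@continuous_const 0) (lexx 0).
rewrite mul0r => h; apply/eqP; rewrite -normr_le0 normr_scalar.
by rewrite -scalar_of_real0 ler_scalar_of_real h// => t; rewrite norm1_0.
Qed.

Lemma bounded_functional_sum (I : Type) (r : seq I) (c : I -> K)
    (h : I -> T -> X) : (forall i, continuous (h i)) ->
  F (fun t => \sum_(i <- r) c i *: h i t) = \sum_(i <- r) c i * F (h i).
Proof.
move=> hc; elim: r => [|i r ih].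
  by under eq_fun do rewrite big_nil; rewrite big_nil bounded_functional0.
under eq_fun do rewrite big_cons.
by rewrite big_cons Fb.1 ?ih//; exact: continuous_sum.
Qed.

Lemma bounded_functionalZ c f : continuous f ->
  F (fun t => c *: f t) = c * F f.
Proof.
move=> fc; have := Fb.1 c f (fun=> 0) fc (@continuous_const 0).
by under eq_fun do rewrite addr0; rewrite bounded_functional0 addr0.
Qed.

Lemma bounded_functional_close f g c : continuous f -> continuous g -> 0 <= c ->
  (forall t, norm1 (f t - g t) <= c) ->
  scalar_abs (F f) <= scalar_abs (F g) + c * b.
Proof.
move=> fc gc c0 fg.
have := Fb.2 _ _ (continuous_lin (c := -1) gc fc) c0.
rewrite Fb.1// mulN1r => h; rewrite -(subrK (F g) (F f)) addrC.
apply: le_trans (scalar_absD _ _) _; rewrite lerD2l addrC h// => t.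
by rewrite scaleN1r addrC.
Qed.

(** A real supremum dominates its members once the set is bounded above; here [n%:R * b] is a bound,
    since [hnorm] at most 1 forces [norm1] at most [n%:R]. *)
Lemma le_MK f : BL1 f ->
  scalar_abs (F f) <= sup [set scalar_abs (F g) | g in BL1].
Proof.
move=> f1; apply: ub_le_sup; last by exists f.
exists (n%:R * b) => _ [g g1 <-]; apply: Fb.2 => //.
  exact: BL1_continuous.
move=> t; apply: le_trans (norm1_le_hnorm _) _.
by rewrite ler_piMr// BL1_hnorm.
Qed.

End Functional.

Lemma BL1_0 : [set: T] !=set0 -> BL1 (fun _ : T => 0 : X).
Proof.
move=> T0; apply: (@BL1_intro _ 0 0); rewrite ?addr0 ?ler01//.
- by move=> t; rewrite hnorm0.
- by move=> s t; rewrite subrr hnorm0 mul0r.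
Qed.

Lemma MK_le (F : (T -> X) -> K) c : [set: T] !=set0 ->
  (forall f, BL1 f -> scalar_abs (F f) <= c) ->
  sup [set scalar_abs (F f) | f in BL1] <= c.
Proof.
move=> T0 h; apply: ge_sup; last by move=> _ [f f1 <-]; exact: h.
by exists (scalar_abs (F (fun=> 0))), (fun=> 0) => //; exact: BL1_0.
Qed.

(** * Interpolation by a partition of unity *)

Section Interpolation.
Context {q : nat} (c : 'I_q -> T) (w : 'I_q -> T -> R).

Definition interpolate f (x : T) : X :=
  \sum_i scalar_of_real (w i x) *: f (c i).

(** Since the weights sum to 1, the error at [x] is a weighted mean of the vectors [f x - f (c i)],
    and only centres within [d] of [x] carry weight. *)
Lemma interpolate_close (d e : R) f :
  (forall i x, 0 <= w i x) -> (forall x, \sum_i w i x = 1) ->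
  (forall i x, d <= mdist (c i) x -> w i x = 0) ->
  (forall s t, mdist s t < d -> norm1 (f s - f t) <= e) ->
  forall x, norm1 (f x - interpolate f x) <= e.
Proof.
move=> w0 w1 wd fe x.
have -> : f x - interpolate f x =
    \sum_i scalar_of_real (w i x) *: (f x - f (c i)).
  under [RHS]eq_bigr do rewrite scalerBr.
  rewrite sumrB -scaler_suml -(big_morph _ scalar_of_realD scalar_of_real0).
  by rewrite w1 scalar_of_real1 scale1r.
apply: le_trans (norm1_sum _) _; rewrite -[leRHS]mul1r -(w1 x) mulr_suml.
apply: ler_sum => i _; rewrite norm1Z scalar_abs_of_real ger0_norm//.
have [/wd ->|/fe] := leP d (mdist (c i) x); first by rewrite !mul0r.
by rewrite norm1B => h; rewrite ler_wpM2l.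
Qed.

Lemma interpolate_lipschitz (L : R) f :
  (forall i x y, `|w i x - w i y| <= L * mdist x y) ->
  forall x y, norm1 (interpolate f x - interpolate f y) <=
    (L * \sum_i norm1 (f (c i))) * mdist x y.
Proof.
move=> wL x y; rewrite -sumrB; apply: le_trans (norm1_sum _) _.
rewrite mulrAC mulr_sumr; apply: ler_sum => i _.
rewrite -scalerBl norm1Z ler_wpM2r ?norm1_ge0//.
by rewrite -scalar_of_realB scalar_abs_of_real.
Qed.

(** Only the coefficients depend on [f]; the functions they multiply form one fixed finite family,
    the source of uniformity over the unit ball. *)
Lemma interpolate_sum f : interpolate f = fun x =>
  \sum_(p : 'I_q * 'I_n) f (c p.1) 0 p.2 *:
    (scalar_of_real (w p.1 x) *: delta_mx 0 p.2).
Proof.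
apply/funext => x.
rewrite -(pair_bigA _ (fun i j => f (c i) 0 j *:
  (scalar_of_real (w i x) *: delta_mx 0 j))) /=.
apply: eq_bigr => i _; rewrite [in LHS](row_sum_delta (f (c i))) scaler_sumr.
by apply: eq_bigr => j _; rewrite !scalerA mulrC.
Qed.

Lemma continuous_tent (L : R) i j :
  (forall i x y, `|w i x - w i y| <= L * mdist x y) ->
  continuous (fun x => scalar_of_real (w i x) *: delta_mx 0 j : X).
Proof.
move=> wL.
apply: (@lipschitz_continuous _ _ _ _ _ (L * norm1 (delta_mx 0 j : X))).
move=> x y; rewrite -scalerBl norm1Z mulrAC ler_wpM2r ?norm1_ge0//.
by rewrite -scalar_of_realB scalar_abs_of_real.
Qed.

End Interpolation.

(** * The two implications for sequences of functionals *)

Lemma MK_cvg_pointwise (b : R) (F : nat -> (T -> X) -> K) :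
  [set: T] !=set0 -> (forall m, bounded_functional b (F m)) ->
  sup [set scalar_abs (F m f) | f in BL1] @[m --> \oo] --> (0 : R) ->
  forall f, continuous f -> F m f @[m --> \oo] --> (0 : K).
Proof.
move=> T0 Fb FMK f fc; apply/cvg_scalarP => e e0.
have b0 : 0 < 2 * (`|b| + 1) by rewrite mulr_gt0// ltr_wpDl.
(* Multiplied by [b], this interpolation error costs at most [e / 2]. *)
have d0 : 0 < e / (2 * (`|b| + 1)) by rewrite divr_gt0.
have [d dgt0 fd] := compact_unif_continuous T_compact fc d0.
have [q [c [w [L [w0 w1 wd wL]]]]] :=
  lipschitz_partition_of_unity T_compact dgt0.
pose g := interpolate c w f.
have fg := interpolate_close w0 w1 wd (fun s t st => ltW (fd s t st)).
have gL := interpolate_lipschitz c f wL.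
have gc : continuous g := lipschitz_continuous gL.
have [M M0 gM] := compact_norm1_bounded T_compact gc.
set L' := L * _ in gL.
(* [C] bounds the sup norm plus the Lipschitz constant of [g], so scaling by [C^-1] brings [g] into
   the unit ball. The absolute value covers a possibly negative [L']. *)
pose C := M + `|L'|; have C0 : 0 < C by rewrite ltr_pwDl.
have g1 : BL1 (fun t => scalar_of_real C^-1 *: g t).
  apply: (@BL1_intro _ (C^-1 * M) (C^-1 * `|L'|)) => //.
  - by rewrite mulr_ge0// invr_ge0 ltW.
  - move=> t; rewrite hnormZ scalar_abs_of_real gtr0_norm ?invr_gt0//.
    by rewrite ler_wpM2l ?invr_ge0 ?(ltW C0)// (le_trans (hnorm_le_norm1 _)).
  - move=> s t; rewrite -scalerBr hnormZ scalar_abs_of_real.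
    rewrite gtr0_norm ?invr_gt0//.
    rewrite -mulrA ler_wpM2l ?invr_ge0 ?(ltW C0)//.
    apply: le_trans (hnorm_le_norm1 _) _; apply: le_trans (gL s t) _.
    by rewrite ler_wpM2r ?mdist_ge0// ler_norm.
  - by rewrite -mulrDr mulVf// gt_eqF.
(* Undoing the scaling by [C^-1] turns this threshold into [e / 2] for [g]. *)
have eC : 0 < e / 2 / C by rewrite !divr_gt0.
have /cvgrPdist_lt/(_ _ eC) := FMK; apply: filterS => m.
rewrite sub0r normrN => /(le_lt_trans (ler_norm _)) Mm.
have := le_lt_trans (le_MK (Fb m) g1) Mm.
rewrite (bounded_functionalZ (Fb m))// scalar_absM scalar_abs_of_real.
rewrite gtr0_norm ?invr_gt0// mulrC ltr_pM2r ?invr_gt0// => gm.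
rewrite subr0 [ltRHS]splitr.
apply: le_lt_trans (bounded_functional_close (Fb m) fc gc (ltW d0) fg) _.
apply: ltr_leD => //.
rewrite invfM mulrA -[leLHS]mulrA ger_pMr ?divr_gt0//.
rewrite mulrC ler_pdivrMr ?ltr_wpDl// mul1r.
by rewrite (le_trans (ler_norm _))// lerDl.
Qed.

Lemma pointwise_cvg_MK (b : R) (F : nat -> (T -> X) -> K) :
  [set: T] !=set0 -> (forall m, bounded_functional b (F m)) ->
  (forall f, continuous f -> F m f @[m --> \oo] --> (0 : K)) ->
  sup [set scalar_abs (F m f) | f in BL1] @[m --> \oo] --> (0 : R).
Proof.
move=> T0 Fb F0; apply/cvgrPdist_lt => e e0.
have b0 : 0 < `|b| + 1 by rewrite ltr_wpDl.
have e40 : 0 < e / 4 by rewrite divr_gt0.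
pose d := e / 4 / (`|b| + 1); have d0 : 0 < d by rewrite divr_gt0.
(* Functions of the unit ball are 1-Lipschitz for [hnorm], so at this scale they all vary by at most
   [d] in [norm1]. *)
have d'0 : 0 < d / n.+1%:R by rewrite divr_gt0.
have [q [c [w [L [w0 w1 wd wL]]]]] :=
  lipschitz_partition_of_unity T_compact d'0.
pose h (p : 'I_q * 'I_n) x : X := scalar_of_real (w p.1 x) *: delta_mx 0 p.2.
have hc p : continuous (h p) by exact: continuous_tent wL.
(* The successor keeps [N] positive even if the index type is empty. *)
pose N := #|{: 'I_q * 'I_n}|.+1.
have eN : 0 < e / 4 / N%:R by rewrite divr_gt0.
(* Finitely many convergences hold simultaneously, and the index is fixed before any [f] of the unit
   ball is chosen. *)
have : \forall m \near \oo, forall p, scalar_abs (F m (h p)) < e / 4 / N%:R.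
  apply: filter_forall => p; have /cvg_scalarP/(_ _ eN) := F0 _ (hc p).
  by apply: filterS => m; rewrite subr0.
apply: filterS => m Fm; rewrite sub0r normrN ger0_norm; last first.
  exact: le_trans (scalar_abs_ge0 _) (le_MK (Fb m) (BL1_0 T0)).
apply: (@le_lt_trans _ _ (e / 2)); last by rewrite gtr_pMr// invf_lt1 ?ltr1n.
apply: MK_le => // f f1.
have fd s t : mdist s t < d / n.+1%:R -> norm1 (f s - f t) <= d.
  move=> st; apply: le_trans (norm1_le_hnorm _) _.
  apply: (@le_trans _ _ (n%:R * (d / n.+1%:R))).
    by rewrite ler_wpM2l// (le_trans (BL1_lipschitz _ _ f1))// ltW.
  by rewrite mulrCA ger_pMr// ler_pdivrMr// mul1r ler_nat.
have fg := interpolate_close w0 w1 wd fd.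
have gc : continuous (interpolate c w f).
  exact: lipschitz_continuous (interpolate_lipschitz c f wL).
have fc := BL1_continuous f1.
apply: le_trans (bounded_functional_close (Fb m) fc gc (ltW d0) fg) _.
have -> : e / 2 = e / 4 + e / 4 by field.
apply: lerD; last first.
  rewrite /d -[leLHS]mulrA ger_pMr// mulrC ler_pdivrMr// mul1r.
  by rewrite (le_trans (ler_norm _))// lerDl.
rewrite interpolate_sum (bounded_functional_sum (Fb m) _ _ hc).
apply: le_trans (scalar_abs_sum _) _.
apply: (@le_trans _ _ (\sum_(p : 'I_q * 'I_n) e / 4 / N%:R)).
  (* The coefficients are coordinates of values of [f], hence bounded by 1. *)
  apply: ler_sum => p _; rewrite scalar_absM -[leRHS]mul1r.
  rewrite ler_pM ?scalar_abs_ge0 ?(ltW (Fm p))//.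
  by rewrite (le_trans (scalar_abs_le_hnorm _ _)) ?BL1_hnorm.
rewrite sumr_const -[leLHS]mulr_natl mulrCA ger_pMr// ler_pdivrMr// mul1r.
by rewrite ler_nat leqnSn.
Qed.

(** * Application to integrals and the weak* topology *)

Lemma vintegral_bounded_functional (a : R) (mu nu : set T -> X) :
  cabv_ball a mu -> cabv_ball a nu ->
  bounded_functional (2 * a) (vintegral (mu \- nu)).
Proof.
move=> mua nua; split=> [c f g fc gc|f c fc c0 fle].
  have [s sf] := continuous_converges_uniformly T_compact fc.
  have [s' sg] := continuous_converges_uniformly T_compact gc.
  rewrite (vintegralB mua nua (converges_uniformly_lin c sf sg)).
  rewrite (vintegralB mua nua sf) (vintegralB mua nua sg).
  rewrite (vintegral_lin _ mua sf sg) (vintegral_lin _ nua sf sg).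
  by rewrite opprD addrACA mulrBr.
have [s sf] := continuous_converges_uniformly T_compact fc.
rewrite (vintegralB mua nua sf); apply: le_trans (scalar_absD _ _) _.
rewrite scalar_absN [2 * a]mulr_natl mulr2n mulrDr.
exact: (lerD (vintegral_le mua sf fle c0) (vintegral_le nua sf fle c0)).
Qed.

Lemma vintegralB_cvg0 (a : R) (mu_ : nat -> set T -> X) (mu : set T -> X) f :
  (forall m, cabv_ball a (mu_ m)) -> cabv_ball a mu -> continuous f ->
  vintegral (mu_ m \- mu) f @[m --> \oo] --> (0 : K) <->
  vintegral (mu_ m) f @[m --> \oo] --> vintegral mu f.
Proof.
move=> mu_a mua /(continuous_converges_uniformly T_compact)[s sf].
split=> /cvg_scalarP h; apply/cvg_scalarP => e /h; apply: filterS => m;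
by rewrite (vintegralB (mu_a m) mua sf) subr0.
Qed.

(** A basic neighbourhood tests finitely many functions, so finitely many eventual conditions are
    intersected; conversely, one function with one radius already defines a neighbourhood. *)
Lemma weak_star_cvgP (mu_ : nat -> set T -> X) (mu : set T -> X) :
  (forall m, cabv (mu_ m)) ->
  mu_ m @[m --> \oo] --> weak_star_nbhs mu <->
  forall f, continuous f -> vintegral (mu_ m \- mu) f @[m --> \oo] --> (0 : K).
Proof.
move=> mu_c; split=> [h f fc|h U [p [F [e [Fc e0 FU]]]]].
  apply/cvg_scalarP => e e0.
  pose U := [set nu | cabv nu /\
    forall i : 'I_1, scalar_abs (vintegral (nu \- mu) f) < e].
  have /h hU : weak_star_nbhs mu U by exists 1%N, (fun=> f), e; split.
  have {}hU : \forall m \near \oo, U (mu_ m) := hU.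
  by apply: filterS hU => m [_ /(_ ord0)]; rewrite subr0.
have : \forall m \near \oo,
    forall i, scalar_abs (vintegral (mu_ m \- mu) (F i)) < e.
  apply: filter_forall => i; have /cvg_scalarP/(_ _ e0) := h _ (Fc i).
  by apply: filterS => m; rewrite subr0.
move=> hm; have {}hm : \forall m \near \oo, U (mu_ m); last exact: hm.
by apply: filterS hm => m hm; apply: FU.
Qed.

End BoundedLipschitz.

Theorem theorem12 (R : realType) (k : scalar_kind) (T : metricType R)
    (T_compact : compact [set: T]) (T_two : exists s t : T, s <> t)
    (n : nat) (n_ge1 : (1 <= n)%N) (a : R) (a_gt0 : 0 < a)
    (mu_ : nat -> set T -> 'rV[scalar_field R k]_n)
    (mu : set T -> 'rV[scalar_field R k]_n)
    (mu_a : forall m, cabv_ball a (mu_ m)) (mua : cabv_ball a mu) :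
  (MK_norm (mu_ m \- mu) @[m --> \oo] --> (0 : R)
     <-> mu_ m @[m --> \oo] --> weak_star_nbhs mu)
  /\
  (mu_ m @[m --> \oo] --> weak_star_nbhs mu
     <-> forall f : T -> 'rV[scalar_field R k]_n, continuous f ->
           vintegral (mu_ m) f @[m --> \oo] --> vintegral mu f).
Proof.
have mu_c m : cabv (mu_ m) by case: (mu_a m).
have T0 : [set: T] !=set0 by case: T_two => t _; exists t.
(* The constant [2 * a] is the same for all [m]: this is the equicontinuity on which both directions
   rest. *)
have Fb m := vintegral_bounded_functional T_compact (mu_a m) mua.
rewrite (weak_star_cvgP mu mu_c); split; split.
- exact: (MK_cvg_pointwise T_compact T0 Fb).
- exact: (pointwise_cvg_MK T_compact T0 Fb).
- by move=> h f fc; apply/(vintegralB_cvg0 T_compact mu_a mua fc); exact: h.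
- by move=> h f fc; apply/(vintegralB_cvg0 T_compact mu_a mua fc); exact: h.
Qed.
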